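(* Let $\beta>0$ and $\varepsilon\in(0,1]$. Let $\pi_0=\pi_{\mathrm{ref}}$ and, for $n\ge 1$, let $\pi_n$ be a policy solving $$\pi_n\in\arg\max_{\pi}\ \mathbb{E}_{q\sim\rho_{\mathcal Q}}\Big\{\omega^+_\varepsilon(p_{n-1}(q))\,\mathbb{E}_{o\sim\pi(\cdot|q)}\mathbf{1}_{r(q,o)=1}-\omega^-_\varepsilon(p_{n-1}(q))\,\mathbb{E}_{o\sim\pi(\cdot|q)}\mathbf{1}_{r(q,o)=0}\Big\}-\beta\,\mathsf{KL}(\pi\|\pi_{\mathrm{ref}}),$$ where the maximum is over all policies and $p_{n-1}(q)=\mathbb{E}_{o\sim\pi_{n-1}(\cdot|q)}\mathbf{1}_{r(q,o)=1}$. Then for all $n\ge1$ (for $\rho_{\mathcal Q}$-almost every $q$ and almost every $o$) $$\pi_n(o|q)=\frac{1}{Z_{n-1}(q)}\,\pi_{\mathrm{ref}}(o|q)\exp\!\left(\frac1\beta\Big(\omega^+_\varepsilon(p_{n-1}(q))\mathbf{1}_{r(q,o)=1}-\omega^-_\varepsilon(p_{n-1}(q))\mathbf{1}_{r(q,o)=0}\Big)\right),$$ where $$Z_{n-1}(q)=p_{\mathrm{ref}}(q)\exp\!\Big(\tfrac1\beta\omega^+_\varepsilon(p_{n-1}(q))\Big)+(1-p_{\mathrm{ref}}(q))\exp\!\Big(-\tfrac1\beta\omega^-_\varepsilon(p_{n-1}(q))\Big)$$ and $p_{\mathrm{ref}}(q)=\mathbb{E}_{o\sim\pi_{\mathrm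{ref}}(\cdot|q)}\mathbf{1}_{r(q,o)=1}$.
   Context: $\rho_{\mathcal Q}$ is a probability distribution on the prompt space $\mathcal Q$; $\mathcal O$ is the outcome space with a fixed $\sigma$-finite base measure (counting measure when $\mathcal O$ is countable). A policy $\pi$ assigns (measurably) to each $q\in\mathcal Q$ a probability density $\pi(\cdot|q)$ on $\mathcal O$. The reward is a measurable function $r:\mathcal Q\times\mathcal O\to\{0,1\}$; $\pi_{\mathrm{ref}}$ is a fixed reference policy. $\mathsf{KL}(\pi\|\pi')=\mathbb{E}_{q\sim\rho_{\mathcal Q}}\mathbb{E}_{o\sim\pi(\cdot|q)}\log\frac{\pi(o|q)}{\pi'(o|q)}\in[0,\infty]$ (the objective is $-\infty$ when it is infinite). The weights are $\omega^+_{\varepsilon}(p)=\frac{1-p}{\sqrt{p(1-p)+\varepsilon}}$ and $\omega^-_{\varepsilon}(p)=\frac{p}{\sqrt{p(1-p)+\varepsilon}}$ for $p\in[0,1]$. *)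

(* Defs.v *)
From HB Require Import structures.
From mathcomp Require Import all_boot all_order all_algebra.
From mathcomp Require Import all_classical all_reals all_analysis.

Set Implicit Arguments.
Unset Strict Implicit.
Unset Printing Implicit Defensive.

Import Order.TTheory GRing.Theory Num.Theory.

Local Open Scope classical_set_scope.
Local Open Scope ring_scope.

(* Densities are taken with respect to the base measure [mu] on the outcome
   space [O]; measurability is joint in the prompt and the outcome. *)
Record is_policy (dQ dO : measure_display) (Q : measurableType dQ)
    (O : measurableType dO) (R : realType)
    (mu : {sigma_finite_measure set O -> \bar R}) (pi : Q -> O -> R) : Prop :=
  IsPolicy {
    policy_measurable : measurable_fun setT (fun x : Q * O => pi x.1 x.2) ;
    policy_ge0 : forall q o, 0 <= pi q o ;
    policy_total : forall q, (\int[mu]_o (pi q o)%:E = 1)%E }.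

Definition outcome_mean (dO : measure_display) (O : measurableType dO)
    (R : realType) (mu : {sigma_finite_measure set O -> \bar R})
    (f : O -> R) (X : O -> \bar R) : \bar R :=
  (\int[mu]_o ((f o)%:E * X o))%E.

(* The reward is [bool]-valued: [true] stands for 1 and [false] for 0. *)
Definition success_prob (dQ dO : measure_display) (Q : measurableType dQ)
    (O : measurableType dO) (R : realType)
    (mu : {sigma_finite_measure set O -> \bar R}) (r : Q -> O -> bool)
    (pi : Q -> O -> R) (q : Q) : R :=
  fine (outcome_mean mu (pi q) (fun o => (\1_[set o' | r q o' = true] o)%:E)).

(* The logarithm of the ratio is extended-real valued: division by 0 yields
   [+oo], [lne 0 = -oo] and [0 * y = 0] for every [y : \bar R]. Hence an outcome
   with pi = 0 contributes 0, and one with pi > 0 and pi' = 0 contributes [+oo].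
   The negative part of the integrand is at most (pi' - pi)^+, so both integrals
   are well defined. *)
Definition KL (dQ dO : measure_display) (Q : measurableType dQ)
    (O : measurableType dO) (R : realType) (rho : probability Q R)
    (mu : {sigma_finite_measure set O -> \bar R})
    (pi pi' : Q -> O -> R) : \bar R :=
  (\int[rho]_q
     outcome_mean mu (pi q) (fun o => lne ((pi q o)%:E / (pi' q o)%:E)))%E.

Definition omega_plus (R : realType) (eps p : R) : R :=
  (1 - p) / Num.sqrt (p * (1 - p) + eps).

Definition omega_minus (R : realType) (eps p : R) : R :=
  p / Num.sqrt (p * (1 - p) + eps).

(* [p] is the success probability of the previous iterate. The integral against
   [rho] is finite, so the value is [-oo] exactly when the KL term is [+oo]. *)
Definition objective (dQ dO : measure_display) (Q : measurableType dQ)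
    (O : measurableType dO) (R : realType) (rho : probability Q R)
    (mu : {sigma_finite_measure set O -> \bar R}) (r : Q -> O -> bool)
    (beta eps : R) (pi_ref : Q -> O -> R) (p : Q -> R)
    (pi : Q -> O -> R) : \bar R :=
  (\int[rho]_q
     ((omega_plus eps (p q))%:E *
        outcome_mean mu (pi q) (fun o => (\1_[set o' | r q o' = true] o)%:E) -
      (omega_minus eps (p q))%:E *
        outcome_mean mu (pi q) (fun o => (\1_[set o' | r q o' = false] o)%:E))
   - beta%:E * KL rho mu pi pi_ref)%E.

Definition is_argmax_policy (dQ dO : measure_display) (Q : measurableType dQ)
    (O : measurableType dO) (R : realType)
    (mu : {sigma_finite_measure set O -> \bar R})
    (J : (Q -> O -> R) -> \bar R) (pi : Q -> O -> R) : Prop :=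
  is_policy mu pi /\
  forall pi' : Q -> O -> R, is_policy mu pi' -> (J pi' <= J pi)%E.

Definition partition_fun (R : realType) (beta eps p_ref p : R) : R :=
  p_ref * expR (beta^-1 * omega_plus eps p) +
  (1 - p_ref) * expR (- (beta^-1 * omega_minus eps p)).

(* Main.v *)
(* The optimum is identified by a Gibbs variational argument. With the claimed
   maximizer g = pi_ref * exp t, where t is the log-tilt normalised by Z, one
   has pointwise
     f ln (f / pi_ref) = [f ln (f / g) + g - f] + (f - g + f t),
   whose bracket is nonnegative and vanishes only at f = g. The last term
   integrates to the reward part of the objective (over beta) minus ln Z, so for
   every policy f
     J(f) = beta E[ln Z] - beta E[int (f ln (f / g) + g - f)],
   and J(f) >= J(g) forces the bracket to vanish almost everywhere. *)
Require Import Defs.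
From HB Require Import structures.
From mathcomp Require Import all_boot all_order all_algebra.
From mathcomp Require Import all_classical all_reals all_analysis.
From mathcomp Require Import measurable_realfun ring lra.

Set Implicit Arguments.
Unset Strict Implicit.
Unset Printing Implicit Defensive.

Import Order.TTheory GRing.Theory Num.Theory.

Local Open Scope classical_set_scope.
Local Open Scope ring_scope.

(** * Pointwise Bregman divergence and the effect of an exponential tilt *)

(* The pointwise Bregman divergence of [x * ln x - x]. *)
Definition bregman (R : realType) (a b : R) : \bar R :=
  (a%:E * lne (a%:E / b%:E) + (b - a)%:E)%E.

(** Resolves the conventions for division by 0 and [lne 0] into three cases, so that later
    computations with nonzero arguments stay in the reals. *)
Lemma mul_lne_divE (R : realType) (a b : R) : 0 <= a -> 0 <= b ->
  (a%:E * lne (a%:E / b%:E))%E =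
  if a == 0 then 0%E else if b == 0 then +oo%E else (a * ln (a / b))%:E.
Proof.
move=> a0 b0; have [->|an0] := eqVneq a 0; first by rewrite mul0e.
have agt0 : 0 < a by rewrite lt_neqAle eq_sym an0.
have [->|bn0] := eqVneq b 0.
  by rewrite /inve eqxx gt0_muley ?lte_fin// gt0_muley ?lte_fin.
have bgt0 : 0 < b by rewrite lt_neqAle eq_sym bn0.
by rewrite /inve (negbTE bn0) -EFinM lne_EFin ?divr_gt0// -EFinM.
Qed.

(** This is [1 + y < expR y] for nonzero y, taken at y = - ln x. Strictness is what later forces
    equality of densities. *)
Lemma subr1_lnVP (R : realType) (x : R) : 0 < x -> x != 1 -> 1 - x^-1 < ln x.
Proof.
move=> x0 x1; have := @expR_gt1Dx R (- ln x).
rewrite expRN lnK ?posrE// oppr_eq0 ln_eq0// => /(_ x1).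
by lra.
Qed.

Lemma bregmanxx (R : realType) (a : R) : 0 <= a -> bregman a a = 0%E.
Proof.
move=> a0; rewrite /bregman mul_lne_divE// subrr adde0.
by have [//|an0] := eqVneq a 0; rewrite divff// ln1 mulr0.
Qed.

Lemma bregman_gt0 (R : realType) (a b : R) : 0 <= a -> 0 <= b -> a != b ->
  (0 < bregman a b)%E.
Proof.
move=> a0 b0 ab; rewrite /bregman mul_lne_divE//.
have [az|an0] := eqVneq a 0.
  by rewrite add0e lte_fin az subr0 lt_neqAle b0 -az ab.
have agt0 : 0 < a by rewrite lt_neqAle eq_sym an0.
have [bz|bn0] := eqVneq b 0; first by rewrite addye.
have bgt0 : 0 < b by rewrite lt_neqAle eq_sym bn0.
rewrite -EFinD lte_fin.
have abn1 : a / b != 1.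
  by apply: contraNneq ab => ab1; rewrite -[a](divfK bn0) ab1 mul1r.
have := subr1_lnVP (divr_gt0 agt0 bgt0) abn1.
rewrite invf_div => ineq.
(* With x = a / b, the divergence is a times the strictly positive gap ln x - (1 - 1 / x). *)
suff -> : a * ln (a / b) + (b - a) = a * (ln (a / b) - (1 - b / a)).
  by rewrite mulr_gt0// subr_gt0.
by field.
Qed.

Lemma bregman_ge0 (R : realType) (a b : R) : 0 <= a -> 0 <= b ->
  (0 <= bregman a b)%E.
Proof.
move=> a0 b0; have [<-|ab] := eqVneq a b; first by rewrite bregmanxx.
exact/ltW/bregman_gt0.
Qed.

(** For positive a and b, ln (a / (b exp t)) = ln (a / b) - t. Since exp t never vanishes, b and b
    exp t have the same zeros, so the infinite cases agree as well. *)
Lemma mul_lne_div_tilt (R : realType) (a b t : R) : 0 <= a -> 0 <= b ->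
  (a%:E * lne (a%:E / b%:E))%E =
  (bregman a (b * expR t) + (a - b * expR t + a * t)%:E)%E.
Proof.
move=> a0 b0; have e0 := expR_gt0 t.
rewrite /bregman !mul_lne_divE// ?mulr_ge0 ?(ltW e0)//.
rewrite mulf_eq0 (gt_eqF e0) orbF.
have [->|an0] := eqVneq a 0; first by rewrite add0e -EFinD; congr EFin; ring.
have [_|bn0] := eqVneq b 0; first by [].
have agt0 : 0 < a by rewrite lt_neqAle eq_sym an0.
have bgt0 : 0 < b by rewrite lt_neqAle eq_sym bn0.
rewrite -!EFinD !ln_div ?posrE ?mulr_gt0// lnM ?posrE// expRK.
by congr EFin; ring.
Qed.

Lemma measurable_bregman (d : measure_display) (T : measurableType d)
    (R : realType) (f g : T -> R) :
  measurable_fun setT f -> measurable_fun setT g ->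
  (forall x, 0 <= f x) -> (forall x, 0 <= g x) ->
  measurable_fun setT (fun x => bregman (f x) (g x)).
Proof.
move=> mf mg f0 g0; apply: emeasurable_funD; last first.
  by apply/measurable_EFinP; exact: measurable_funB.
(* The reciprocal becomes a power with exponent -1, legitimate since [g] is nonnegative, so that
   measurability of powers applies. *)
have -> : (fun x => (f x)%:E * lne ((f x)%:E / (g x)%:E))%E =
    (fun x => if f x == 0 then 0%E else if g x == 0 then +oo%E
              else (f x * ln (f x * g x `^ (-1)))%:E).
  by apply/funext => x; rewrite mul_lne_divE// powR_inv1.
have m0 (h : T -> R) : measurable_fun setT h ->
    measurable_fun setT (fun x => h x == 0).
  by move=> mh; exact: measurable_fun_eqr.
apply: measurable_fun_ifT; [exact: m0|exact: measurable_cst|].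
apply: measurable_fun_ifT; [exact: m0|exact: measurable_cst|].
apply/measurable_EFinP; apply: measurable_funM => //.
apply: (measurableT_comp (@measurable_ln R)).
apply: measurable_funM => //.
exact: (measurableT_comp (measurable_powR (-1))).
Qed.

(** * Additivity of the integral when one term may have infinite integral *)

(* Unlike in [integralD], [f] need not be integrable. *)
Lemma integral_ge0_integrableD (d : measure_display) (T : measurableType d)
    (R : realType) (mu : {measure set T -> \bar R}) (f : T -> \bar R)
    (u : T -> R) :
  measurable_fun setT f -> (forall x, 0 <= f x)%E ->
  mu.-integrable setT (EFin \o u) ->
  (\int[mu]_x (f x + (u x)%:E) = \int[mu]_x f x + \int[mu]_x (u x)%:E)%E.
Proof.
move=> mf f0 iu; have mu_ : measurable_fun setT u.
  by apply/measurable_EFinP; exact: measurable_int iu.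
have [foo|fNoo] := ltP (\int[mu]_x f x)%E +oo%E.
  rewrite integralD//; apply/integrableP; split => //.
  by under eq_integral do rewrite gee0_abs//.
have fy : (\int[mu]_x f x = +oo)%E by apply/eqP; rewrite -leye_eq.
have uy : (\int[mu]_x `|(u x)%:E| < +oo)%E by case/integrableP : iu.
have mabs : measurable_fun setT (fun x => `|(u x)%:E|%E).
  by apply: measurableT_comp => //; exact/measurable_EFinP.
have mfu : measurable_fun setT (fun x => (f x + (u x)%:E)%E).
  by apply: emeasurable_funD => //; exact/measurable_EFinP.
(* In the remaining case [f] has infinite integral. As [f] is nonnegative, the negative part of f +
   u is dominated by |u|. *)
have Ny : (\int[mu]_x ((fun x => (f x + (u x)%:E)) ^\- x) < +oo)%E.
  apply: le_lt_trans uy; apply: ge0_le_integral => //.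
    exact: measurable_funeneg.
  move=> x _; rewrite funenegE ge_max abse_ge0 andbT.
  rewrite leeNl (le_trans _ (leeDr _ (f0 x)))//.
  by rewrite lee_fin lerNnormlW.
(* Otherwise f <= (f + u)^+ + |u| would make the integral of [f] finite. *)
have Py : (\int[mu]_x ((fun x => (f x + (u x)%:E)) ^\+ x) = +oo)%E.
  apply/eqP; rewrite -leye_eq leNgt; apply/negP => Py.
  move: fy; apply/eqP; rewrite lt_eqF//.
  apply: (@le_lt_trans _ _ (\int[mu]_x
     ((fun x => (f x + (u x)%:E)) ^\+ x + `|(u x)%:E|))%E); last first.
    rewrite ge0_integralD//; last exact: measurable_funepos.
    by rewrite lte_add_pinfty.
  apply: ge0_le_integral => //.
    by apply: emeasurable_funD => //; exact: measurable_funepos.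
  move=> x _; rewrite funeposE.
  apply: (@le_trans _ _ (f x + (u x)%:E + `|(u x)%:E|)%E).
    rewrite -addeA leeDl// -EFinD lee_fin.
    by rewrite -lerBlDr sub0r lerNnormlW.
  by rewrite leeD2r// le_max lexx.
rewrite fy integralE Py !addye//.
  by rewrite gt_eqF// ltNye_eq integrable_fin_num.
by move: Ny; case: (integral _ _ _).
Qed.

(** * Bounds and measurability of the weights and of the partition function *)

(** Since p (1 - p) >= 0, the denominator is at least sqrt eps. The bound is uniform in p, which
    later gives integrability over prompts. *)
Lemma omega_plus_bound (R : realType) (eps p : R) : 0 < eps -> 0 <= p <= 1 ->
  0 <= omega_plus eps p <= (Num.sqrt eps)^-1.
Proof.
move=> e0 /andP[p0 p1]; have s0 : 0 < Num.sqrt eps by rewrite sqrtr_gt0.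
have pp : 0 <= p * (1 - p) by rewrite mulr_ge0// subr_ge0.
have le_s : Num.sqrt eps <= Num.sqrt (p * (1 - p) + eps).
  by rewrite ler_wsqrtr// lerDr.
have s'0 := lt_le_trans s0 le_s.
rewrite /omega_plus divr_ge0 ?subr_ge0 ?(ltW s'0)//=.
rewrite -[leRHS]mul1r ler_pM ?subr_ge0 ?invr_ge0 ?(ltW s'0)//.
  by rewrite gerBl.
by rewrite lef_pV2// posrE.
Qed.

(** The symmetry p -> 1 - p transfers bounds and measurability from [omega_plus] to
    [omega_minus]. *)
Lemma omega_minus_onem (R : realType) (eps p : R) :
  omega_minus eps p = omega_plus eps (1 - p).
Proof. by rewrite /omega_minus /omega_plus subKr mulrC [p * _]mulrC mulrC. Qed.

Lemma omega_minus_bound (R : realType) (eps p : R) : 0 < eps -> 0 <= p <= 1 ->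
  0 <= omega_minus eps p <= (Num.sqrt eps)^-1.
Proof.
move=> e0 /andP[p0 p1]; rewrite omega_minus_onem omega_plus_bound//.
by rewrite subr_ge0 p1 gerBl.
Qed.

Lemma measurable_omega_plus (d : measure_display) (T : measurableType d)
    (R : realType) (eps : R) (p : T -> R) : 0 < eps ->
  (forall x, 0 <= p x <= 1) -> measurable_fun setT p ->
  measurable_fun setT (fun x => omega_plus eps (p x)).
Proof.
move=> e0 p01 mp.
(* The reciprocal square root is a power with exponent -1/2, because its argument is nonnegative. *)
have -> : (fun x => omega_plus eps (p x)) =
    (fun x => (1 - p x) * (p x * (1 - p x) + eps) `^ (- 2^-1)).
  apply/funext => x; have /andP[p0 p1] := p01 x.
  by rewrite powRN powR12_sqrt// addr_ge0 ?(ltW e0)// mulr_ge0// subr_ge0.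
have m1p : measurable_fun setT (fun x => 1 - p x) by exact: measurable_funB.
apply: measurable_funM => //.
apply: (measurableT_comp (measurable_powR _)).
by apply: measurable_funD => //; exact: measurable_funM.
Qed.

Lemma measurable_omega_minus (d : measure_display) (T : measurableType d)
    (R : realType) (eps : R) (p : T -> R) : 0 < eps ->
  (forall x, 0 <= p x <= 1) -> measurable_fun setT p ->
  measurable_fun setT (fun x => omega_minus eps (p x)).
Proof.
move=> e0 p01 mp; under eq_fun do rewrite omega_minus_onem.
apply: measurable_omega_plus => //; last exact: measurable_funB.
by move=> x; have /andP[p0 p1] := p01 x; rewrite subr_ge0 p1 gerBl.
Qed.

(** The partition function is a convex combination, with weights [p_ref] and [1 - p_ref], of two
    exponentials whose exponents are at most beta^-1 / sqrt eps in absolute value. *)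
Lemma partition_fun_bound (R : realType) (beta eps p_ref p : R) :
  0 < beta -> 0 < eps -> 0 <= p_ref <= 1 -> 0 <= p <= 1 ->
  expR (- (beta^-1 * (Num.sqrt eps)^-1)) <= partition_fun beta eps p_ref p
    <= expR (beta^-1 * (Num.sqrt eps)^-1).
Proof.
move=> b0 e0 /andP[r0 r1] p01; rewrite /partition_fun.
have /andP[a0 aK] := omega_plus_bound e0 p01.
have /andP[c0 cK] := omega_minus_bound e0 p01.
have bi0 : 0 <= beta^-1 by rewrite invr_ge0 ltW.
have K0 : 0 <= (Num.sqrt eps)^-1 by rewrite invr_ge0 sqrtr_ge0.
set x := expR (beta^-1 * omega_plus _ _).
set y := expR (- (beta^-1 * omega_minus _ _)).
set m := expR (- _); set M := expR (beta^-1 * (Num.sqrt eps)^-1).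
have mx : m <= x.
  by rewrite ler_expR (@le_trans _ _ 0)// ?oppr_le0 mulr_ge0.
have xM : x <= M by rewrite ler_expR ler_wpM2l.
have my : m <= y by rewrite ler_expR lerN2 ler_wpM2l.
have yM : y <= M.
  by rewrite ler_expR (@le_trans _ _ 0)// ?oppr_le0 mulr_ge0.
have s0 : 0 <= 1 - p_ref by rewrite subr_ge0.
apply/andP; split.
  have -> : m = p_ref * m + (1 - p_ref) * m by ring.
  by apply: lerD; exact: ler_wpM2l.
have -> : M = p_ref * M + (1 - p_ref) * M by ring.
by apply: lerD; exact: ler_wpM2l.
Qed.

Lemma partition_fun_gt0 (R : realType) (beta eps p_ref p : R) :
  0 < beta -> 0 < eps -> 0 <= p_ref <= 1 -> 0 <= p <= 1 ->
  0 < partition_fun beta eps p_ref p.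
Proof.
move=> b0 e0 r01 p01; have /andP[+ _] := partition_fun_bound b0 e0 r01 p01.
exact/lt_le_trans/expR_gt0.
Qed.

Lemma ln_partition_fun_bound (R : realType) (beta eps p_ref p : R) :
  0 < beta -> 0 < eps -> 0 <= p_ref <= 1 -> 0 <= p <= 1 ->
  `|ln (partition_fun beta eps p_ref p)| <= beta^-1 * (Num.sqrt eps)^-1.
Proof.
move=> b0 e0 r01 p01; have Z0 := partition_fun_gt0 b0 e0 r01 p01.
have /andP[lo hi] := partition_fun_bound b0 e0 r01 p01.
by rewrite ler_norml -ler_expR -[X in _ && X]ler_expR lnK ?posrE// lo hi.
Qed.

Lemma measurable_ln_partition_fun (d : measure_display) (T : measurableType d)
    (R : realType) (beta eps : R) (p_ref p : T -> R) : 0 < eps ->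
  (forall x, 0 <= p x <= 1) ->
  measurable_fun setT p_ref -> measurable_fun setT p ->
  measurable_fun setT (fun x => ln (partition_fun beta eps (p_ref x) (p x))).
Proof.
move=> e0 p01 mr mp; apply: (measurableT_comp (@measurable_ln R)).
have mop := measurable_omega_plus e0 p01 mp.
have mom := measurable_omega_minus e0 p01 mp.
apply: measurable_funD; apply: measurable_funM => //.
- apply: (measurableT_comp (@measurable_expR R)).
  exact: measurable_funM.
- exact: measurable_funB.
- apply: (measurableT_comp (@measurable_expR R)).
  by apply: measurable_funN; exact: measurable_funM.
Qed.

(** * Integrability of policies and success probabilities *)

Lemma bounded_integrable (d : measure_display) (T : measurableType d)
    (R : realType) (P : probability T R) (f : T -> R) (M : R) :
  measurable_fun setT f -> (forall x, `|f x| <= M) ->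
  P.-integrable setT (EFin \o f).
Proof.
move=> mf fM; apply: measurable_bounded_integrable => //.
  by rewrite -ge0_fin_numE ?fin_num_measure.
exists M; split; first exact: num_real.
by move=> x Mx y _; apply: le_trans (ltW Mx).
Qed.

Lemma measurable_policy (dQ dO : measure_display) (Q : measurableType dQ)
    (O : measurableType dO) (R : realType)
    (mu : {sigma_finite_measure set O -> \bar R}) (f : Q -> O -> R) (q : Q) :
  is_policy mu f -> measurable_fun setT (f q).
Proof.
by move=> [mf _ _]; exact: (measurableT_comp mf (pair1_measurable q)).
Qed.

Lemma integrable_policy (dQ dO : measure_display) (Q : measurableType dQ)
    (O : measurableType dO) (R : realType)
    (mu : {sigma_finite_measure set O -> \bar R}) (f : Q -> O -> R) (q : Q) :
  is_policy mu f -> mu.-integrable setT (EFin \o f q).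
Proof.
move=> pf; apply/integrableP; split.
  by apply/measurable_EFinP; exact: measurable_policy pf.
case: pf => _ f0 f1.
under eq_integral do rewrite /= ger0_norm//.
by rewrite f1 ltry.
Qed.

Lemma integrable_policyM (dQ dO : measure_display) (Q : measurableType dQ)
    (O : measurableType dO) (R : realType)
    (mu : {sigma_finite_measure set O -> \bar R}) (f : Q -> O -> R) (q : Q)
    (h : O -> R) (M : R) :
  is_policy mu f -> measurable_fun setT h -> (forall o, `|h o| <= M) ->
  mu.-integrable setT (fun o => (f q o * h o)%:E).
Proof.
move=> pf mh hM; have mf := measurable_policy q pf.
have /integrableMl := integrable_policy q pf; apply => //.
exists M; split; first exact: num_real.
by move=> x Mx y _; apply: le_trans (ltW Mx).
Qed.

Lemma measurable_reward_section (dQ dO : measure_display)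
    (Q : measurableType dQ) (O : measurableType dO) (r : Q -> O -> bool)
    (q : Q) : measurable_fun setT (fun x : Q * O => r x.1 x.2) ->
  measurable_fun setT (r q).
Proof. by move=> mr; exact: (measurableT_comp mr (pair1_measurable q)). Qed.

Lemma indic_fiberE (T : Type) (R : realType) (r : T -> bool) (b : bool)
    (x : T) : \1_[set y | r y = b] x = (r x == b)%:R :> R.
Proof.
by rewrite indicE; congr (_%:R); congr nat_of_bool; apply/asboolP/eqP.
Qed.

(** The two means are nonnegative and add up to the mass 1 of the policy, so both are finite. Hence
    [fine] loses nothing in [success_prob]. *)
Lemma outcome_mean_success (dQ dO : measure_display) (Q : measurableType dQ)
    (O : measurableType dO) (R : realType)
    (mu : {sigma_finite_measure set O -> \bar R}) (r : Q -> O -> bool)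
    (f : Q -> O -> R) (q : Q) :
  measurable_fun setT (fun x : Q * O => r x.1 x.2) -> is_policy mu f ->
  [/\ outcome_mean mu (f q) (fun o => (\1_[set o' | r q o' = true] o)%:E) =
        (success_prob mu r f q)%:E,
      outcome_mean mu (f q) (fun o => (\1_[set o' | r q o' = false] o)%:E) =
        (1 - success_prob mu r f q)%:E &
      0 <= success_prob mu r f q <= 1].
Proof.
move=> mr pf; have mf := measurable_policy q pf.
have mrq := measurable_reward_section q mr.
have [_ f0 f1] := pf.
have mfb b : measurable_fun setT
    (fun o => ((f q o)%:E * (\1_[set o' | r q o' = b] o)%:E)%E).
  under eq_fun do rewrite -EFinM.
  apply/measurable_EFinP; apply: measurable_funM => //.
  apply: measurable_indic; rewrite -[X in measurable X]setTI.
  exact: (mrq measurableT [set b]).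
have fb0 b o : (0 <= (f q o)%:E * (\1_[set o' | r q o' = b] o)%:E)%E.
  by rewrite -EFinM lee_fin mulr_ge0.
rewrite /success_prob /outcome_mean.
set A := (\int[mu]_o _)%E; set B := (\int[mu]_o _)%E.
have A0 : (0 <= A)%E by apply: integral_ge0.
have B0 : (0 <= B)%E by apply: integral_ge0.
have AB : (A + B = 1)%E.
  rewrite -ge0_integralD// -(f1 q); apply: eq_integral => o _.
  rewrite -!EFinM -EFinD !indic_fiberE -mulrDr.
  by case: (r q o) => /=; rewrite ?addr0 ?add0r mulr1.
move: A B A0 B0 AB => [a| |] [b| |]//=.
rewrite !lee_fin -EFinD => a0 b0 [] ab.
by split => //; [congr EFin; lra|lra].
Qed.

(** Tonelli: the success probability is a partial integral of a jointly measurable nonnegative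
    function. *)
Lemma measurable_success_prob (dQ dO : measure_display)
    (Q : measurableType dQ) (O : measurableType dO) (R : realType)
    (mu : {sigma_finite_measure set O -> \bar R}) (r : Q -> O -> bool)
    (f : Q -> O -> R) :
  measurable_fun setT (fun x : Q * O => r x.1 x.2) -> is_policy mu f ->
  measurable_fun setT (success_prob mu r f).
Proof.
move=> mr [mf f0 _].
have -> : success_prob mu r f = fine \o fubini_F mu
    (fun x : Q * O => (f x.1 x.2 * (if r x.1 x.2 then 1 else 0))%:E).
  apply/funext => q; rewrite /success_prob /outcome_mean /fubini_F /=.
  congr fine; apply: eq_integral => o _; rewrite -EFinM indic_fiberE.
  by case: (r q o).
apply: measurableT_comp => //.
apply: measurable_fun_fubini_tonelli_F.
  apply/measurable_EFinP; apply: measurable_funM => //.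
  exact: measurable_fun_ifT.
by move=> [q o] /=; rewrite lee_fin mulr_ge0//; case: ifP.
Qed.

(** An integrand that sees the outcome only through its reward is a combination of the two
    indicators. This serves both to normalise the tilted policy and to average its log-density. *)
Lemma integral_policy_if (dQ dO : measure_display) (Q : measurableType dQ)
    (O : measurableType dO) (R : realType)
    (mu : {sigma_finite_measure set O -> \bar R}) (r : Q -> O -> bool)
    (f : Q -> O -> R) (q : Q) (c1 c2 : R) :
  measurable_fun setT (fun x : Q * O => r x.1 x.2) -> is_policy mu f ->
  (\int[mu]_o (f q o * (if r q o then c1 else c2))%:E)%E =
  (success_prob mu r f q * c1 + (1 - success_prob mu r f q) * c2)%:E.
Proof.
move=> mr pf; have [pT pF _] := outcome_mean_success q mr pf.
have mrq := measurable_reward_section q mr.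
have ifb b : mu.-integrable setT
    (fun o => (f q o)%:E * (\1_[set o' | r q o' = b] o)%:E)%E.
  under eq_fun do rewrite -EFinM.
  apply: (@integrable_policyM _ _ _ _ _ _ _ _ _ 1) => //.
    apply: measurable_indic; rewrite -[X in measurable X]setTI.
    exact: (mrq measurableT [set b]).
  by move=> o; rewrite indic_fiberE; case: (_ == _); rewrite ?normr1 ?normr0.
rewrite EFinD ![(_ * c1)]mulrC ![(_ * c2)]mulrC !EFinM -pT -pF.
rewrite /outcome_mean -!integralZl// -integralD//; last 2 first.
- exact: integrableZl.
- exact: integrableZl.
apply: eq_integral => o _; rewrite -!EFinM -EFinD; congr EFin.
by rewrite !indic_fiberE; case: (r q o) => /=; ring.
Qed.

(** * Splitting the KL divergence along a tilt *)

(* Both integrals on the right are well defined even when [KL] is [+oo]. *)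
Lemma KL_tilt (dQ dO : measure_display) (Q : measurableType dQ)
    (O : measurableType dO) (R : realType) (rho : probability Q R)
    (mu : {sigma_finite_measure set O -> \bar R}) (f s t : Q -> O -> R)
    (v : Q -> R) :
  is_policy mu f -> is_policy mu s ->
  is_policy mu (fun q o => s q o * expR (t q o)) ->
  (forall q, mu.-integrable setT (fun o => (f q o * t q o)%:E)) ->
  (forall q, \int[mu]_o (f q o * t q o)%:E = (v q)%:E)%E ->
  rho.-integrable setT (EFin \o v) ->
  KL rho mu f s =
  (\int[rho]_q \int[mu]_o bregman (f q o) (s q o * expR (t q o))
   + \int[rho]_q (v q)%:E)%E.
Proof.
move=> pf ps pg ift ftv iv; set g := fun q o => _ in pg.
have [mf f0 f1] := pf; have [mg g0 g1] := pg; have s0 := policy_ge0 ps.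
have inner q : (outcome_mean mu (f q) (fun o => lne ((f q o)%:E / (s q o)%:E)) =
    \int[mu]_o bregman (f q o) (g q o) + (v q)%:E)%E.
  rewrite /outcome_mean.
  under eq_integral => o _ do rewrite (mul_lne_div_tilt (t q o))//.
  have ifg : mu.-integrable setT (fun o => (f q o)%:E - (g q o)%:E)%E.
    by apply: integrableB => //; exact: integrable_policy.
  rewrite integral_ge0_integrableD; first last.
  - exact: (integrableD measurableT ifg (ift q)).
  - by move=> o; exact: bregman_ge0 (f0 q o) (g0 q o).
  - apply: measurable_bregman (f0 q) (g0 q); first exact: measurable_policy pf.
    exact: measurable_policy pg.
  (* [f q] and [g q] both have mass 1, so their difference integrates to 0 and only the mean of
     [t q] remains. *)
  congr (_ + _)%E; under eq_integral do rewrite EFinD EFinB.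
  rewrite integralD// (@integralB_EFin _ _ _ _ _ (f q) (g q))//.
  - by rewrite f1 g1 subee// add0e ftv.
  - exact: integrable_policy pf.
  - exact: integrable_policy pg.
rewrite /KL; under eq_integral do rewrite inner.
(* The same splitting, now over prompts: the inner divergence is nonnegative, its integral possibly
   infinite, and [v] is integrable. *)
apply: integral_ge0_integrableD => //.
- apply: (measurable_fun_fubini_tonelli_F
    (fun x : Q * O => bregman (f x.1 x.2) (g x.1 x.2))).
    exact: measurable_bregman.
  by move=> x; exact: bregman_ge0.
- by move=> q; apply: integral_ge0 => o _; exact: bregman_ge0 (f0 q o) (g0 q o).
Qed.

(** * The tilted policy *)

(* The logarithmic density with respect to [pi_ref] of the claimed maximizer,
   on outcomes of reward [b]. *)
Definition log_tilt (R : realType) (beta eps p_ref p : R) (b : bool) : R :=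
  if b then beta^-1 * omega_plus eps p - ln (partition_fun beta eps p_ref p)
  else - (beta^-1 * omega_minus eps p) - ln (partition_fun beta eps p_ref p).

Lemma log_tilt_bound (R : realType) (beta eps p_ref p : R) (b : bool) :
  0 < beta -> 0 < eps -> 0 <= p_ref <= 1 -> 0 <= p <= 1 ->
  `|log_tilt beta eps p_ref p b| <=
    beta^-1 * (Num.sqrt eps)^-1 + beta^-1 * (Num.sqrt eps)^-1.
Proof.
move=> b0 e0 r01 p01; have Zb := ln_partition_fun_bound b0 e0 r01 p01.
have /andP[a0 aK] := omega_plus_bound e0 p01.
have /andP[c0 cK] := omega_minus_bound e0 p01.
have bi0 : 0 <= beta^-1 by rewrite invr_ge0 ltW.
rewrite /log_tilt.
case: b; apply: (le_trans (ler_normB _ _)); apply: lerD => //.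
  by rewrite (ger0_norm (mulr_ge0 bi0 a0)) ler_wpM2l.
by rewrite normrN (ger0_norm (mulr_ge0 bi0 c0)) ler_wpM2l.
Qed.

(** Subtracting ln Z in the exponent divides by Z, and the weighted sum of the unnormalised
    exponentials is Z itself. *)
Lemma mean_expR_log_tilt (R : realType) (beta eps p_ref p : R) :
  0 < partition_fun beta eps p_ref p ->
  p_ref * expR (log_tilt beta eps p_ref p true) +
  (1 - p_ref) * expR (log_tilt beta eps p_ref p false) = 1.
Proof.
move=> Z0; rewrite /log_tilt !expRD (expRN (ln _)) lnK ?posrE//.
move: Z0; rewrite /partition_fun.
move: (expR _) (expR (- _)) => x y Z0.
by field; rewrite gt_eqF.
Qed.

(** Exactly one of the two indicators is 1, and it selects the branch of [log_tilt]. This converts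
    the tilt used in the argument to the closed form of the theorem. *)
Lemma tilted_policyE (R : realType) (beta eps p_ref p s : R) (T : Type)
    (r : T -> bool) (o : T) : 0 < partition_fun beta eps p_ref p ->
  s * expR (log_tilt beta eps p_ref p (r o)) =
  (partition_fun beta eps p_ref p)^-1 * s *
  expR (beta^-1 * (omega_plus eps p * \1_[set o' | r o' = true] o
                   - omega_minus eps p * \1_[set o' | r o' = false] o)).
Proof.
move=> Z0; rewrite !indic_fiberE /log_tilt; case: (r o) => /=.
  rewrite mulr1 mulr0 subr0 expRD expRN lnK ?posrE//; ring.
rewrite mulr0 mulr1 sub0r mulrN expRD (expRN (ln _)) lnK ?posrE//; ring.
Qed.

Lemma measurable_log_tilt (dQ dO : measure_display) (Q : measurableType dQ)
    (O : measurableType dO) (R : realType) (beta eps : R)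
    (r : Q -> O -> bool) (p_ref p : Q -> R) : 0 < eps ->
  measurable_fun setT (fun x : Q * O => r x.1 x.2) ->
  (forall q, 0 <= p q <= 1) ->
  measurable_fun setT p_ref -> measurable_fun setT p ->
  measurable_fun setT
    (fun x : Q * O => log_tilt beta eps (p_ref x.1) (p x.1) (r x.1 x.2)).
Proof.
move=> e0 mr p01 mref mp.
have mlnZ := measurable_ln_partition_fun beta e0 p01 mref mp.
have mop := measurable_omega_plus e0 p01 mp.
have mom := measurable_omega_minus e0 p01 mp.
apply: measurable_fun_ifT => //.
  apply: (@measurableT_comp _ _ _ _ _ _ (fun q =>
    beta^-1 * omega_plus eps (p q) - ln (partition_fun beta eps (p_ref q) (p q))) _ fst) => //.
  by apply: measurable_funB => //; exact: measurable_funM.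
apply: (@measurableT_comp _ _ _ _ _ _ (fun q =>
  - (beta^-1 * omega_minus eps (p q)) - ln (partition_fun beta eps (p_ref q) (p q))) _ fst) => //.
by apply: measurable_funB => //; apply: measurable_funN; exact: measurable_funM.
Qed.

(** Makes the tilted density an admissible competitor in the maximization. *)
Lemma is_policy_tilt (dQ dO : measure_display) (Q : measurableType dQ)
    (O : measurableType dO) (R : realType)
    (mu : {sigma_finite_measure set O -> \bar R}) (beta eps : R)
    (r : Q -> O -> bool) (s : Q -> O -> R) (p : Q -> R) :
  0 < beta -> 0 < eps ->
  measurable_fun setT (fun x : Q * O => r x.1 x.2) -> is_policy mu s ->
  measurable_fun setT p -> (forall q, 0 <= p q <= 1) ->
  is_policy mu
    (fun q o => s q o *
       expR (log_tilt beta eps (success_prob mu r s q) (p q) (r q o))).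
Proof.
move=> b0 e0 mr ps mp p01; have [ms s0 s1] := ps; split.
- apply: measurable_funM => //; apply: (measurableT_comp (@measurable_expR R)).
  by apply: measurable_log_tilt => //; exact: measurable_success_prob.
- by move=> q o; rewrite mulr_ge0// expR_ge0.
- move=> q; have [_ _ s01] := outcome_mean_success q mr ps.
  (* [log_tilt] is a conditional on the reward; moving the exponential into its branches gives the
     form of [integral_policy_if]. *)
  under eq_integral => o _ do
    rewrite (fun_if (fun x => expR x)).
  rewrite (integral_policy_if _ _ _ mr ps) -[RHS]/(1%:E); congr EFin.
  exact/mean_expR_log_tilt/partition_fun_gt0.
Qed.

(** * The variational identity and uniqueness of the maximizer *)

(* The Gibbs variational identity: relative to its value at the tilted policy,
   the objective loses [beta] times a mean Bregman divergence. *)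
Lemma objective_tilt (dQ dO : measure_display) (Q : measurableType dQ)
    (O : measurableType dO) (R : realType) (rho : probability Q R)
    (mu : {sigma_finite_measure set O -> \bar R}) (beta eps : R)
    (r : Q -> O -> bool) (s f : Q -> O -> R) (p : Q -> R) :
  0 < beta -> 0 < eps ->
  measurable_fun setT (fun x : Q * O => r x.1 x.2) ->
  is_policy mu s -> is_policy mu f ->
  measurable_fun setT p -> (forall q, 0 <= p q <= 1) ->
  objective rho mu r beta eps s p f =
  (beta%:E * \int[rho]_q
     (ln (partition_fun beta eps (success_prob mu r s q) (p q)))%:E
   - beta%:E * \int[rho]_q \int[mu]_o
     bregman (f q o) (s q o *
       expR (log_tilt beta eps (success_prob mu r s q) (p q) (r q o))))%E.
Proof.
move=> b0 e0 mr ps pf mp p01.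
have mps := measurable_success_prob mr ps.
have mpf := measurable_success_prob mr pf.
have ps01 q : 0 <= success_prob mu r s q <= 1.
  by have [] := outcome_mean_success q mr ps.
have pf01 q : 0 <= success_prob mu r f q <= 1.
  by have [] := outcome_mean_success q mr pf.
have mop := measurable_omega_plus e0 p01 mp.
have mom := measurable_omega_minus e0 p01 mp.
have ilnZ : rho.-integrable setT
    (fun q => (ln (partition_fun beta eps (success_prob mu r s q) (p q)))%:E).
  apply: (@bounded_integrable _ _ _ _ _ (beta^-1 * (Num.sqrt eps)^-1)).
    exact: measurable_ln_partition_fun.
  by move=> q; exact: ln_partition_fun_bound.
(* [S] is the reward part of the objective at a fixed prompt, bounded because the weights are. *)
pose S q := omega_plus eps (p q) * success_prob mu r f q -
  omega_minus eps (p q) * (1 - success_prob mu r f q).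
have iS : rho.-integrable setT (EFin \o S).
  apply: (@bounded_integrable _ _ _ _ _
    ((Num.sqrt eps)^-1 + (Num.sqrt eps)^-1)).
    apply: measurable_funB; apply: measurable_funM => //.
    exact: measurable_funB.
  move=> q; have /andP[f0 f1] := pf01 q.
  have /andP[a0 aK] := omega_plus_bound e0 (p01 q).
  have /andP[c0 cK] := omega_minus_bound e0 (p01 q).
  apply: (le_trans (ler_normB _ _)); apply: lerD.
    by rewrite (ger0_norm (mulr_ge0 a0 f0)) -[leRHS]mulr1; exact: ler_pM.
  have f1' : 0 <= 1 - success_prob mu r f q by rewrite subr_ge0.
  rewrite (ger0_norm (mulr_ge0 c0 f1')) -[leRHS]mulr1; apply: ler_pM => //.
  by rewrite gerBl.
(* [v q] is the mean under [f q] of the log-tilt: the reward part over beta, minus ln Z. *)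
pose v q := beta^-1 * S q -
  ln (partition_fun beta eps (success_prob mu r s q) (p q)).
have ibS : rho.-integrable setT (fun q => (beta^-1)%:E * (S q)%:E)%E.
  exact: integrableZl.
have iv : rho.-integrable setT (EFin \o v) by exact: (integrableB _ ibS ilnZ).
have vE : (\int[rho]_q (v q)%:E = (beta^-1)%:E * \int[rho]_q (S q)%:E -
    \int[rho]_q
      (ln (partition_fun beta eps (success_prob mu r s q) (p q)))%:E)%E.
  by rewrite -integralZl// -integralB.
rewrite /objective.
have -> : (\int[rho]_q
     ((omega_plus eps (p q))%:E *
        outcome_mean mu (f q) (fun o => (\1_[set o' | r q o' = true] o)%:E) -
      (omega_minus eps (p q))%:E *
        outcome_mean mu (f q) (fun o => (\1_[set o' | r q o' = false] o)%:E))
    = \int[rho]_q (S q)%:E)%E.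
  apply: eq_integral => q _.
  by have [-> -> _] := outcome_mean_success q mr pf.
rewrite (@KL_tilt _ _ _ _ _ rho mu f s (fun q o =>
  log_tilt beta eps (success_prob mu r s q) (p q) (r q o)) v)//; last 3 first.
- exact: is_policy_tilt.
- move=> q; apply: (@integrable_policyM _ _ _ _ _ _ f q (fun o =>
    log_tilt beta eps (success_prob mu r s q) (p q) (r q o)) _ pf); last first.
    by move=> o; exact: log_tilt_bound.
  exact: (measurableT_comp (measurable_log_tilt beta e0 mr p01 mps mp)
    (pair1_measurable q)).
- move=> q; rewrite (integral_policy_if _ _ _ mr pf); congr EFin.
  by rewrite /v /S; ring.
rewrite vE; move: (integrable_fin_num measurableT iS).
move: (integrable_fin_num measurableT ilnZ).
set B := (\int[rho]_q \int[mu]_o _)%E.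
have B0 : (0 <= B)%E.
  apply: integral_ge0 => q _; apply: integral_ge0 => o _.
  apply: bregman_ge0; first exact: policy_ge0 pf q o.
  by rewrite mulr_ge0 ?expR_ge0//; exact: policy_ge0 ps q o.
(* The integrals of [S] and ln Z are finite and [B] is nonnegative. If [B] is finite the identity is
   algebra in the reals; if [B] is [+oo], both sides are [-oo]. *)
rewrite /comp; move: (\int[rho]_q (S q)%:E)%E
  (\int[rho]_q (ln (partition_fun _ _ _ _))%:E)%E B B0
  => [S'| |] [L| |] [B| |]//= B0 _ _.
  rewrite -!(EFinM, EFinB, EFinD); congr EFin.
  by field; rewrite gt_eqF.
by rewrite addye// gt0_muley ?lte_fin.
Qed.

(** Comparing [f] with the tilted policy, whose loss is zero, forces the loss of [f] to be zero
    too. *)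
Lemma argmax_policy_tilt (dQ dO : measure_display) (Q : measurableType dQ)
    (O : measurableType dO) (R : realType) (rho : probability Q R)
    (mu : {sigma_finite_measure set O -> \bar R}) (beta eps : R)
    (r : Q -> O -> bool) (s f : Q -> O -> R) (p : Q -> R) :
  0 < beta -> 0 < eps ->
  measurable_fun setT (fun x : Q * O => r x.1 x.2) -> is_policy mu s ->
  measurable_fun setT p -> (forall q, 0 <= p q <= 1) ->
  is_argmax_policy mu (objective rho mu r beta eps s p) f ->
  {ae rho, forall q, {ae mu, forall o,
    f q o = s q o *
      expR (log_tilt beta eps (success_prob mu r s q) (p q) (r q o))}}.
Proof.
move=> b0 e0 mr ps mp p01 [pf fmax].
have pg := is_policy_tilt b0 e0 mr ps mp p01.
have := fmax _ pg; rewrite !objective_tilt//.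
have [mf f0 _] := pf; have [mg g0 _] := pg.
(* The divergence of the tilted policy from itself vanishes, leaving only its ln Z term. *)
under [X in (_ - _ * X <= _)%E]eq_integral => q _.
  under eq_integral => o _ do rewrite bregmanxx//.
  rewrite integral0; over.
rewrite integral0 mule0 sube0.
have Bge0 q : (0 <= \int[mu]_o bregman (f q o) (s q o *
       expR (log_tilt beta eps (success_prob mu r s q) (p q) (r q o))))%E.
  by apply: integral_ge0 => o _; exact: bregman_ge0 (f0 q o) (g0 q o).
have ps01 q : 0 <= success_prob mu r s q <= 1.
  by have [] := outcome_mean_success q mr ps.
have ilnZ : rho.-integrable setT
    (fun q => (ln (partition_fun beta eps (success_prob mu r s q) (p q)))%:E).
  apply: (@bounded_integrable _ _ _ _ _ (beta^-1 * (Num.sqrt eps)^-1)).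
    by apply: measurable_ln_partition_fun => //; exact: measurable_success_prob.
  by move=> q; exact: ln_partition_fun_bound.
set B := (\int[rho]_q \int[mu]_o _)%E => J_le.
have B0 : B = 0%E.
  have : (0 <= B)%E by apply: integral_ge0 => q _; exact: Bge0.
  (* The ln Z term is finite, so it cancels when [B] is finite; [B = +oo] would put the value [-oo]
     above a finite one. *)
  move: (integrable_fin_num measurableT ilnZ) J_le.
  move: (\int[rho]_q _)%E B => [L| |] [B| |]//= _.
    rewrite -!EFinM -EFinB !lee_fin => J_le B_ge0.
    congr EFin; apply/eqP; rewrite eq_le B_ge0 andbT.
    by rewrite -(ler_pM2l b0) mulr0; lra.
  by rewrite gt0_muley ?lte_fin.
have mB : measurable_fun setT (fun q => \int[mu]_o bregman (f q o) (s q o *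
     expR (log_tilt beta eps (success_prob mu r s q) (p q) (r q o))))%E.
  apply: (measurable_fun_fubini_tonelli_F (fun x : Q * O => bregman (f x.1 x.2)
    (s x.1 x.2 * expR (log_tilt beta eps (success_prob mu r s x.1) (p x.1)
                         (r x.1 x.2))))).
    exact: measurable_bregman.
  by move=> x; exact: bregman_ge0 (f0 _ _) (g0 _ _).
(* A nonnegative function with zero integral vanishes almost everywhere: first in the prompt, then,
   for almost every prompt, in the outcome. *)
have /(ae_eq_integral_abs rho measurableT mB) : (\int[rho]_q `|\int[mu]_o
    bregman (f q o) (s q o *
     expR (log_tilt beta eps (success_prob mu r s q) (p q) (r q o)))| = 0)%E.
  by rewrite -B0; apply: eq_integral => q _; rewrite gee0_abs.
apply: filterS => q /(_ I) Bq0.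
have mBq : measurable_fun setT (fun o => bregman (f q o) (s q o *
     expR (log_tilt beta eps (success_prob mu r s q) (p q) (r q o)))).
  apply: measurable_bregman (f0 q) (g0 q); first exact: measurable_policy pf.
  exact: measurable_policy pg.
have /(ae_eq_integral_abs mu measurableT mBq) : (\int[mu]_o `|
    bregman (f q o) (s q o *
     expR (log_tilt beta eps (success_prob mu r s q) (p q) (r q o)))| = 0)%E.
  rewrite -[RHS]Bq0; apply: eq_integral => o _; rewrite gee0_abs//.
  exact: bregman_ge0 (f0 q o) (g0 q o).
(* Where the densities differ the divergence is strictly positive, so its vanishing gives
   equality. *)
apply: filterS => o /(_ I) /eqP; apply: contraTeq => neq.
by rewrite gt_eqF//; exact: bregman_gt0 (f0 q o) (g0 q o) neq.
Qed.

Theorem theorem1 (R : realType) (dQ dO : measure_display)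
    (Q : measurableType dQ) (O : measurableType dO)
    (rho : probability Q R) (mu : {sigma_finite_measure set O -> \bar R})
    (r : Q -> O -> bool)
    (mr : measurable_fun setT (fun x : Q * O => r x.1 x.2))
    (pi_ref : Q -> O -> R) (pi_ref_policy : is_policy mu pi_ref)
    (beta eps : R) (beta_gt0 : 0 < beta) (eps_gt0 : 0 < eps) (eps_le1 : eps <= 1)
    (pi : nat -> Q -> O -> R) (pi_0 : pi 0%N = pi_ref)
    (pi_S : forall n : nat,
       is_argmax_policy mu
         (objective rho mu r beta eps pi_ref (success_prob mu r (pi n)))
         (pi n.+1)) :
  forall n : nat,
    {ae rho, forall q : Q, {ae mu, forall o : O,
      pi n.+1 q o =
        (partition_fun beta eps (success_prob mu r pi_ref q)
           (success_prob mu r (pi n) q))^-1 *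
        pi_ref q o *
        expR (beta^-1 *
          (omega_plus eps (success_prob mu r (pi n) q)
             * \1_[set o' | r q o' = true] o
           - omega_minus eps (success_prob mu r (pi n) q)
             * \1_[set o' | r q o' = false] o))}}.
Proof.
move=> n.
have pn : is_policy mu (pi n).
  by case: n => [|n]; [rewrite pi_0|have [] := pi_S n].
have p01 q : 0 <= success_prob mu r (pi n) q <= 1.
  by have [] := outcome_mean_success q mr pn.
have := argmax_policy_tilt beta_gt0 eps_gt0 mr pi_ref_policy
  (measurable_success_prob mr pn) p01 (pi_S n).
apply: filterS => q; apply: filterS => o ->; apply: tilted_policyE.
apply: partition_fun_gt0 => //.
by have [] := outcome_mean_success q mr pi_ref_policy.
Qed.
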